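(* Let $k\ge 1$, $n\ge k+3$, and let $\mathbf{c}_0=(1,1,\underbrace{0,\ldots,0}_{k},1,0,0,\ldots,0)\in\mathbb{N}^n$ be the initial configuration on the directed path $P_n$ whose entries equal to $1$ are exactly those in positions $1$, $2$ and $k+3$, all others being $0$. Then $$\mathcal{A}(P_n,\mathbf{c}_0)\simeq\bigvee_{n-k-2}S^1.$$
   Context: $P_n$ is the directed path with vertices $v_1,\dots,v_{n+1}$ and edges $(v_i,v_{i+1})$ for $i=1,\dots,n$. The vertex $v_{n+1}$ is a sink: it never fires, absorbs grains, and is not included in configurations or in the avalanche complex. A configuration is a vector $\mathbf{c}\in\mathbb{N}^n$ ($0\in\mathbb{N}$), where $\mathbf{c}(v_i)$ is the number of grains on $v_i$, $1\le i\le n$. Parallel-firing sandpile dynamics started from $\mathbf{c}_0$: at each time $t=0,1,2,\dots$ the firing set $\sigma_t$ is the set of $v_i$, $1\le i\le n$, with $\mathbf{c}_t(v_i)\ge 1$; all of these fire simultaneously, each sending one grain to $v_{i+1}$, so that $\mathbf{c}_{t+1}(v_i)=\mathbf{c}_t(v_i)-[v_i\in\sigma_t]+[v_{i-1}\in\sigma_t]$ for $1\le i\le n$ (where $[\cdot]$ is $1$ if the condition holds and $0$ otherwise, and the last term is $0$ for $i=1$). The avalanche complex $\mathcal{A}(P_n,\mathbf{c}_0)$ is the simplicial complex generated by the firing sets, i.e. the simplices are all nonempty subsets of the sets $\sigma_t$, $t\ge 0$ (vertices that never fire are not vertices of the complex). $\simeq$ denotes homotopy equivalence, and $\bigvee_m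 X$ is the wedge of $m$ copies of $X$. *)

(* Defs.v *)
From HB Require Import structures.
From mathcomp Require Import all_boot all_order all_algebra.
From mathcomp Require Import all_classical all_reals all_analysis.
From mathcomp Require Import homotopy.

Set Implicit Arguments.
Unset Strict Implicit.
Unset Printing Implicit Defensive.

Import Order.TTheory GRing.Theory Num.Theory.
Import numFieldNormedType.Exports.

Local Open Scope classical_set_scope.
Local Open Scope ring_scope.

Section Homotopy.
Variable R : realType.

(* The homotopy parameter ranges over [0, 1]: the values of H outside
   X * [0, 1] are irrelevant and continuity is for the subspace topology. *)
Definition homotopic (X Y : topologicalType) (f g : X -> Y) : Prop :=
  exists H : X * R -> Y,
    [/\ {within [set: X] `*` `[0, 1], continuous H},
        forall x, H (x, 0) = f x & forall x, H (x, 1) = g x].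

Definition homotopy_equivalent (X Y : topologicalType) : Prop :=
  exists (f : X -> Y) (g : Y -> X),
    [/\ continuous f, continuous g,
        homotopic (g \o f) idfun & homotopic (f \o g) idfun].

Definition sphere (d : nat) : set 'rV[R]_d.+1 :=
  [set x : 'rV[R]_d.+1 | \sum_i x ord0 i ^+ 2 = 1].

Lemma sphere_pole_subproof d : delta_mx ord0 ord0 \in @sphere d.
Proof.
rewrite inE /sphere /= big_ord_recl mxE !eqxx expr1n big1 ?addr0// => i _.
by rewrite mxE /= expr0n.
Qed.

Definition sphere_pole (d : nat) : set_type (@sphere d) :=
  exist _ (delta_mx ord0 ord0) (sphere_pole_subproof d).

(* The wedge of m copies of the d-sphere; the library's wedge over an empty
   family is empty, so this is the usual wedge only for 0 < m. *)
Definition wedge_spheres (m d : nat) : topologicalType :=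
  wedge (fun _ : 'I_m => sphere_pole d).

End Homotopy.

(* A vertex v of the ambient type V is a vertex of K only if [set v] is a
   face of K. *)
Record simplicial_complex (V : finType) := SimplicialComplex {
  faces : set {set V};
  faces_neq0 : forall s, faces s -> s != finset.set0;
  faces_sub : forall s t : {set V},
    faces s -> t \subset s -> t != finset.set0 -> faces t
}.

Section Generated.
Variables (V : finType) (F : set {set V}).

Definition generated_faces : set {set V} :=
  [set s : {set V} | s != finset.set0 /\ exists2 f, F f & s \subset f].

Lemma generated_faces_neq0 s : generated_faces s -> s != finset.set0.
Proof. by case. Qed.

Lemma generated_faces_sub (s t : {set V}) :
  generated_faces s -> t \subset s -> t != finset.set0 -> generated_faces t.
Proof.
move=> [_ [f Ff sf]] ts t0; split=> //; exists f => //.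
exact: fintype.subset_trans ts sf.
Qed.

Definition generated_complex : simplicial_complex V :=
  SimplicialComplex generated_faces_neq0 generated_faces_sub.

End Generated.

(* Barycentric coordinates; as the complex is finite, the topology of the
   realization is the one induced by R^n. *)
Definition barycentric_points (R : realType) (n : nat) (K : simplicial_complex 'I_n)
  : set 'rV[R]_n :=
  [set x : 'rV[R]_n | [/\ forall i, 0 <= x ord0 i, \sum_i x ord0 i = 1
             & faces K [set i : 'I_n | x ord0 i != 0]%SET]].

Definition realization (R : realType) (n : nat) (K : simplicial_complex 'I_n)
  : topologicalType := set_type (@barycentric_points R n K).
Arguments realization R {n} K.

Section Sandpile.
Variable n : nat.

(* The vertex v_(i+1) of the directed path P_n is represented by i : 'I_n;
   the sink v_(n+1) is not represented. *)
Definition config := {ffun 'I_n -> nat}.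

Definition firing_set (c : config) : {set 'I_n} := [set i | (1 <= c i)%N]%SET.

(* The truncated subtraction is exact, since firing vertices have a grain. *)
Definition fire (c : config) : config :=
  [ffun i => (c i - (i \in firing_set c)
              + [exists j : 'I_n, (j.+1 == i :> nat) && (j \in firing_set c)])%N].

Definition config_at (c0 : config) (t : nat) : config := iter t fire c0.

Definition avalanche_complex (c0 : config) : simplicial_complex 'I_n :=
  generated_complex (range (fun t => firing_set (config_at c0 t))).

End Sandpile.

(* One grain on each of v_1, v_2 and v_(k+3), i.e. at indices 0, 1 and k+2. *)
Definition initial_config (n k : nat) : config n :=
  [ffun i : 'I_n => (nat_of_ord i \in [:: 0; 1; k.+2]%N) : nat].

(* Main.v *)
Require Import Defs.
From mathcomp Require Import all_boot all_order all_algebra.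
From mathcomp Require Import all_classical all_reals all_analysis.
From mathcomp Require Import homotopy.
From mathcomp Require Import zify ring lra.

Set Implicit Arguments.
Unset Strict Implicit.
Unset Printing Implicit Defensive.

Import Order.TTheory GRing.Theory Num.Theory.
Import numFieldNormedType.Exports.

Local Open Scope classical_set_scope.
Local Open Scope ring_scope.

(** In each firing step all three grains move one vertex down the path, so the
    firing set at time t is {t, t+1, t+k+2} cut down to the vertices below n.
    The complex is therefore the path 0 - 1 - ... - (n-1), the spine, together
    with the m = n-k-2 triangles {t, t+1, t+k+2}, t < m.  As k >= 1, the index
    differences 1, k+1 and k+2 are distinct, so the two long edges of a triangle
    belong to no other triangle, and distinct triangles meet only in the spine.
    Collapsing each triangle from its free edge {t, t+k+2} leaves the spine
    with the m extra edges {t+1, t+k+2}; contracting the spine leaves a wedge of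
    m circles.

    The proof writes both maps of the equivalence down.  On triangle t let a
    and c be the barycentric coordinates at t and t+k+2, and h = c - a.  The map
    crush sends the spine to the base point and a point of triangle t to the
    point of the t-th circle with parameter h; parameters h <= 0 and h >= 1 are
    the base point.  In the other direction the t-th circle is sent to the
    lasso t: run up the spine from 0 to t+1, cross to t+k+2, run back down the
    spine to 0 (lassos_descend).

    Write the lasso as a path with parameter p, crossing for p in [t+1, t+2].
    Collapsing triangle t sends a point to the lasso at p = t+1+h, and going to
    the circle and back sends it to the lasso at p = L h, where L is the length
    of the lasso and h is clamped to [0, 1].  Interpolating linearly between
    these two parameters, and on the spine between the position of the point and
    0, gives a homotopy (tighten); the collapse itself is homotopic to the
    identity by straight lines inside the facets (tighten0_homotopic).  The other
    composite is a reparametrization of each circle, and the parameters are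
    again interpolated linearly.

    Continuity on the complex comes from pasting over the finite closed cover by
    facets (glue_continuous).  Continuity on the wedge, and on its product
    with [0, 1], comes from a finite family of maps from compact squares,
    jointly onto a Hausdorff space, being a quotient (wedge_homotopy). *)

(** * Pasting, quotients and homotopies *)

Lemma continuous_closed_cover (Y Z : topologicalType) (I : finType)
    (C : I -> set Y) (Fi : I -> Y -> Z) (F : Y -> Z) :
  (forall i, closed (C i)) -> (forall y, exists i, C i y) ->
  (forall i, continuous (Fi i)) -> (forall i y, C i y -> F y = Fi i y) ->
  continuous F.
Proof.
move=> clC covC cFi FE; apply/continuous_closedP => A clA.
have -> : F @^-1` A = \bigcup_(i in [set: I]) (C i `&` Fi i @^-1` A).
  apply/seteqP; split=> [y /= FA|y [i _ [Ci /= FA]]].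
    by have [i Ci] := covC y; exists i => //; split; rewrite //= -(FE i).
  by rewrite /= (FE i).
apply: closed_bigcup; first exact: finite_finset.
move=> i _; apply: closedI; first exact: clC.
by move/continuous_closedP: (cFi i); exact.
Qed.

Lemma within_comp_continuous (X Y Z : topologicalType) (A : set Y)
    (h : X -> Y) (F : Y -> Z) :
  {within A, continuous F} -> continuous h -> (forall x, A (h x)) ->
  continuous (F \o h).
Proof.
move=> /continuous_closedP cF /continuous_closedP ch hA.
apply/continuous_closedP => B clB.
have /closed_subspaceP[V clV VA] := cF _ clB.
have -> : (F \o h) @^-1` B = h @^-1` V; last exact: ch.
apply/seteqP; split=> x /= Bx.
  have : (F @^-1` B `&` A) (h x) by split=> //; exact: hA.
  by rewrite -VA => -[].
have : (V `&` A) (h x) by split=> //; exact: hA.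
by rewrite VA => -[].
Qed.

Lemma pair_continuous (X Y Z : topologicalType) (f : X -> Y) (g : X -> Z) :
  continuous f -> continuous g -> continuous (fun x => (f x, g x)).
Proof. by move=> cf cg x; apply: cvg_pair; [exact: cf|exact: cg]. Qed.

Lemma hausdorff_prod (X Y : topologicalType) :
  hausdorff_space X -> hausdorff_space Y -> hausdorff_space (X * Y)%type.
Proof.
move=> hX hY [x1 y1] [x2 y2] cl; congr pair.
  apply: hX => A B nA nB.
  have [||[a b] [/= Aa Ba]] := cl (A `*` setT) (B `*` setT).
  - by exists (A, setT) => //=; split=> //; exact: filterT.
  - by exists (B, setT) => //=; split=> //; exact: filterT.
  by exists a; split; [case: Aa|case: Ba].
apply: hY => A B nA nB.
have [||[a b] [/= Aa Ba]] := cl (setT `*` A) (setT `*` B).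
- by exists (setT, A) => //=; split=> //; exact: filterT.
- by exists (setT, B) => //=; split=> //; exact: filterT.
by exists b; split; [case: Aa|case: Ba].
Qed.

Lemma hausdorff_set_type (X : topologicalType) (A : set X) :
  hausdorff_space X -> hausdorff_space (set_type A).
Proof.
move=> hX x y cl; apply: val_inj; apply: hX => U V nU nV.
have cv : continuous (set_val : A -> X) by exact: initial_continuous.
have [||z [Uz Vz]] := cl (set_val @^-1` U) (set_val @^-1` V).
- exact: cv.
- exact: cv.
by exists (set_val z).
Qed.

(** A closed set pulls back to a compact set under each [psi i], and its image
    under [q i] is compact, hence closed: a finite family of maps from a compact
    set that is jointly onto [D] detects continuity on [D]. *)
Lemma quotient_within (A B Z : topologicalType) (I : finType) (C : set A)
    (D : set B) (q : I -> A -> B) (psi : I -> A -> Z) (phi : B -> Z) :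
  compact C -> hausdorff_space B -> (forall i, continuous (q i)) ->
  (forall i, continuous (psi i)) -> (forall i a, C a -> D (q i a)) ->
  (forall b, D b -> exists i, exists2 a, C a & q i a = b) ->
  (forall i a, C a -> phi (q i a) = psi i a) ->
  {within D, continuous phi}.
Proof.
move=> kC hB cq cpsi qD Dq phiE; apply/continuous_closedP => F clF.
apply/closed_subspaceP.
exists (\bigcup_(i in [set: I]) (q i @` (C `&` psi i @^-1` F))).
  apply: closed_bigcup; first exact: finite_finset.
  move=> i _; apply: compact_closed => //; apply: continuous_compact.
    by apply: continuous_subspaceT; exact: cq.
  apply: compact_closedI => //.
    by move/continuous_closedP: (cpsi i); exact.
apply/seteqP; split=> b [].
  move=> [i _ [a [Ca psia] <-]] Db; split=> //.
  by change (F (phi (q i a))); rewrite phiE.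
move=> /= Fb Db; split=> //; have [i [a Ca qab]] := Dq _ Db.
by exists i => //; exists a => //; split=> //=; rewrite -phiE // qab.
Qed.

Section Clamp.
Variable R : realType.

Definition clamp01 (y : R) : R := Num.max 0 (Num.min 1 y).

Lemma clamp01_itv (y : R) : 0 <= clamp01 y <= 1.
Proof. by rewrite le_max lexx ge_max ler01 ge_min lexx. Qed.

Lemma clamp01_id (y : R) : 0 <= y <= 1 -> clamp01 y = y.
Proof. by move=> /andP[y0 y1]; rewrite /clamp01 (min_r y1) (max_r y0). Qed.

Lemma clamp01_le0 (y : R) : y <= 0 -> clamp01 y = 0.
Proof.
by move=> y0; rewrite /clamp01 min_r ?max_l//; exact: le_trans y0 ler01.
Qed.

Lemma clamp01_ge1 (y : R) : 1 <= y -> clamp01 y = 1.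
Proof. by move=> y1; rewrite /clamp01 (min_l y1) max_r. Qed.

Section RealValued.
Variables (Y : topologicalType) (f g : Y -> R).
Hypotheses (cf : continuous f) (cg : continuous g).

Lemma continuous_addr : continuous (fun y => f y + g y).
Proof. by move=> y; apply: cvgD; [exact: cf|exact: cg]. Qed.

Lemma continuous_subr : continuous (fun y => f y - g y).
Proof. by move=> y; apply: cvgB; [exact: cf|exact: cg]. Qed.

Lemma continuous_mulr : continuous (fun y => f y * g y).
Proof. by move=> y; apply: cvgM; [exact: cf|exact: cg]. Qed.

Lemma continuous_minr : continuous (fun y => Num.min (f y) (g y)).
Proof.
by move=> y; apply: (@continuous_min R Y f g); [exact: cf|exact: cg].
Qed.

Lemma continuous_clamp01 : continuous (fun y => clamp01 (f y)).
Proof.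
move=> y; apply: (@continuous_max R Y (fun=> 0) (fun y => Num.min 1 (f y))).
  exact: cst_continuous.
by apply: (@continuous_min R Y (fun=> 1) f); [exact: cst_continuous|exact: cf].
Qed.

Lemma continuous_sqrtr : continuous (fun y => Num.sqrt (f y)).
Proof. by move=> y; apply: continuous_comp; [exact: cf|exact: sqrt_continuous]. Qed.

End RealValued.

Lemma continuous_sumr (Y : topologicalType) (I : Type) (s : seq I)
    (P : pred I) (f : I -> Y -> R) :
  (forall i, continuous (f i)) -> continuous (fun y => \sum_(i <- s | P i) f i y).
Proof.
move=> cf; elim: s => [|i s IH].
  by under eq_fun do rewrite big_nil; exact: cst_continuous.
under eq_fun do rewrite big_cons.
by case: (P i) => //; exact: continuous_addr.
Qed.

(** The topology of matrices is the product topology. *)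
Lemma continuous_mx (Y : topologicalType) (m n : nat) (f : Y -> 'M[R]_(m, n)) :
  (forall i j, continuous (fun y => f y i j)) -> continuous f.
Proof.
move=> cf y A [P Py PA]; apply: filterS (PA) _.
have : \forall z \near y, forall ij : 'I_m * 'I_n, P ij.1 ij.2 (f z ij.1 ij.2).
  by apply: filter_forall => -[i j] /=; exact: cf (Py i j).
by apply: filterS => z Pz i j; exact: (Pz (i, j)).
Qed.

End Clamp.

Section HomotopicTheory.
Variables (R : realType) (X Y : topologicalType).
Implicit Types f g h : X -> Y.

(** Precomposing with the retraction of the line onto [0, 1] turns a homotopy
    that is continuous on the strip into one that is continuous everywhere, so
    that homotopies can be composed and pasted without subspace topologies. *)
Lemma homotopicP f g :
  homotopic R f g <-> exists H : X * R -> Y,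
    [/\ continuous H, forall x, H (x, 0) = f x & forall x, H (x, 1) = g x].
Proof.
split=> -[H [cH H0 H1]]; last first.
  by exists H; split=> //; apply: continuous_subspaceT.
exists (H \o (fun z => (z.1, clamp01 z.2))); split=> [|x|x] /=; last 2 first.
- by rewrite clamp01_le0.
- by rewrite clamp01_ge1.
apply: (within_comp_continuous cH) => [|z].
  apply: pair_continuous; first by move=> z; exact: cvg_fst.
  by apply: continuous_clamp01 => z; exact: cvg_snd.
by split=> //=; rewrite in_itv /= clamp01_itv.
Qed.

Lemma homotopic_sym f g : homotopic R f g -> homotopic R g f.
Proof.
move=> /homotopicP[H [cH H0 H1]]; apply/homotopicP.
exists (fun z => H (z.1, 1 - z.2)); split=> [z|x|x] /=; last 2 first.
- by rewrite subr0.
- by rewrite subrr.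
apply: (@continuous_comp _ _ _ (fun z : X * R => (z.1, 1 - z.2)) H);
  last exact: cH.
apply: pair_continuous; first by move=> ?; exact: cvg_fst.
apply: continuous_subr; first exact: cst_continuous.
by move=> ?; exact: cvg_snd.
Qed.

Lemma homotopic_trans f g h :
  homotopic R f g -> homotopic R g h -> homotopic R f h.
Proof.
move=> /homotopicP[H [cH H0 H1]] /homotopicP[K [cK K0 K1]]; apply/homotopicP.
exists (fun z =>
  if z.2 <= 2^-1 then H (z.1, 2 * z.2) else K (z.1, 2 * z.2 - 1)).
split=> [|x|x]; last 2 first.
- by rewrite /= invr_ge0 ler0n mulr0 H0.
- have -> : (1 : R) <= 2^-1 = false by apply/negbTE; rewrite -ltNge; lra.
  by rewrite /= -K1; congr (K (x, _)); lra.
have c2 : continuous (snd : X * R -> R) by move=> z; exact: cvg_snd.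
have c1 : continuous (fst : X * R -> X) by move=> z; exact: cvg_fst.
have cc (a : R) : continuous (fun _ : X * R => a) by exact: cst_continuous.
pose C (b : bool) :=
  if b then [set z : X * R | z.2 <= 2^-1] else [set z | 2^-1 <= z.2].
pose F (b : bool) (z : X * R) :=
  if b then H (z.1, 2 * z.2) else K (z.1, 2 * z.2 - 1).
apply: (@continuous_closed_cover _ _ bool C F).
- case; rewrite /C; last first.
    by move/continuous_closedP: c2 => /(_ _ (@closed_ge R 2^-1)).
  by move/continuous_closedP: c2 => /(_ _ (@closed_le R 2^-1)).
- move=> z; case: (leP z.2 2^-1) => h1; [by exists true|].
  by exists false; exact: ltW.
- case=> z; rewrite /F.
    apply: (@continuous_comp _ _ _ (fun z : X * R => (z.1, 2 * z.2)) H);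
      last exact: cH.
    by apply: pair_continuous => //; exact: continuous_mulr.
  apply: (@continuous_comp _ _ _ (fun z : X * R => (z.1, 2 * z.2 - 1)) K);
    last exact: cK.
  apply: pair_continuous => //; apply: continuous_subr => //.
  exact: continuous_mulr.
- case=> z; rewrite /C /F /= => hz; first by rewrite hz.
  case: ifP => // hz'; have z2 : z.2 = 2^-1 by apply/eqP; rewrite eq_le hz hz'.
  by rewrite z2 mulfV // subrr H1 K0.
Qed.

End HomotopicTheory.

(** * The circle as a quotient of the unit interval *)

Section Circle.
Variable R : realType.
Local Notation circle := (set_type (@sphere R 1)).

(** Setting w = y (1 - y), the entries 1 - 8 w and 4 sqrt(w) (1 - 2 y) wind once
    around the circle, from the pole to the pole, as y runs through [0, 1]. *)
Definition loop_row (c : R) : 'rV[R]_2 :=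
  let y := clamp01 c in
  \row_j (if j == ord0 then 1 - 8 * (y * (1 - y))
          else 4 * Num.sqrt (y * (1 - y)) * (1 - 2 * y)).

Lemma loop_row_sphere c : loop_row c \in @sphere R 1.
Proof.
rewrite inE /sphere /= !big_ord_recl big_ord0 !mxE /= addr0.
have /andP[y0 y1] := clamp01_itv c; set y := clamp01 c in y0 y1 *.
rewrite !exprMn sqr_sqrtr; last by rewrite mulr_ge0 // subr_ge0.
by ring.
Qed.

Definition loop (c : R) : circle := exist _ (loop_row c) (loop_row_sphere c).

Lemma loop_continuous : continuous loop.
Proof.
apply: continuous_comp_initial; apply: continuous_mx => i j.
have cc (a : R) : continuous (fun _ : R => a) by exact: cst_continuous.
have cy : continuous (@clamp01 R) by apply: continuous_clamp01; move=> ?; exact: cvg_id.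
under eq_fun do rewrite /= mxE.
have cq : continuous (fun c => clamp01 c * (1 - clamp01 c) : R).
  by apply: continuous_mulr => //; exact: continuous_subr.
case: (j == ord0).
  by apply: continuous_subr => //; exact: continuous_mulr.
apply: continuous_mulr; first by apply: continuous_mulr => //; exact: continuous_sqrtr.
by apply: continuous_subr => //; exact: continuous_mulr.
Qed.

Lemma loop_clamp c : loop (clamp01 c) = loop c.
Proof. by apply: val_inj; rewrite /= /loop_row (clamp01_id (clamp01_itv c)). Qed.

Lemma loop_pole c : clamp01 c * (1 - clamp01 c) = 0 -> loop c = sphere_pole R 1.
Proof.
move=> y0; apply: val_inj; apply/rowP => j /=; rewrite !mxE /= y0 sqrtr0.
by rewrite !mulr0 mul0r subr0; case: (j == ord0).
Qed.

Lemma loop_le0 c : c <= 0 -> loop c = sphere_pole R 1.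
Proof. by move=> /clamp01_le0 y0; apply: loop_pole; rewrite y0 mul0r. Qed.

Lemma loop_ge1 c : 1 <= c -> loop c = sphere_pole R 1.
Proof. by move=> /clamp01_ge1 y1; apply: loop_pole; rewrite y1 subrr mulr0. Qed.

(** With u = 1 - 8 y (1 - y) and v the second coordinate of the loop,
    1 - 2 y = v / sqrt(2 (1 - u)) away from the pole. *)
Definition angle (z : circle) : R :=
  let u := \val z ord0 ord0 in
  let v := \val z ord0 (lift ord0 ord0) in
  if u == 1 then 0 else (1 - v / Num.sqrt (2 * (1 - u))) / 2.

Lemma angle_pole : angle (sphere_pole R 1) = 0.
Proof. by rewrite /angle /= mxE !eqxx. Qed.

Lemma circle_eq (z : circle) :
  \val z ord0 (lift ord0 ord0) ^+ 2 = (1 - \val z ord0 ord0) * (1 + \val z ord0 ord0).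
Proof.
have h : \val z ord0 ord0 ^+ 2 + \val z ord0 (lift ord0 ord0) ^+ 2 = 1.
  by have := set_valP z; rewrite /sphere /= !big_ord_recl big_ord0 addr0.
by rewrite -[LHS](addKr (\val z ord0 ord0 ^+ 2)) h; ring.
Qed.

Lemma angle_itv z : 0 <= angle z <= 1.
Proof.
rewrite /angle; set u := _ ord0 ord0; set v := _ ord0 _.
have uv : v ^+ 2 = (1 - u) * (1 + u) by exact: circle_eq.
case: eqVneq => [_|u1]; first by rewrite lexx ler01.
have u2 : (1 - u) * (1 + u) >= 0 by rewrite -uv sqr_ge0.
have ult1 : u < 1 by rewrite lt_neqAle u1 /=; nra.
have s0 : 0 < Num.sqrt (2 * (1 - u)) by rewrite sqrtr_gt0; lra.
have s2 : Num.sqrt (2 * (1 - u)) ^+ 2 = 2 * (1 - u) by rewrite sqr_sqrtr; lra.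
have : `|v / Num.sqrt (2 * (1 - u))| <= 1.
  rewrite normrM normfV (gtr0_norm s0) ler_pdivrMr // mul1r.
  rewrite -(@ler_pXn2r _ 2) ?nnegrE ?normr_ge0 ?(ltW s0) //.
  rewrite real_normK ?num_real // s2 uv; nra.
by rewrite ler_norml => /andP[h1 h2]; apply/andP; split; lra.
Qed.

Lemma angleK : cancel angle loop.
Proof.
move=> z; have := angle_itv z; have := circle_eq z.
rewrite /angle; set u := \val z ord0 ord0; set v := \val z ord0 _ => uv.
case: eqVneq => [u1 _|u1 yitv].
  rewrite loop_le0 //; apply: val_inj; apply/rowP => j /=; rewrite mxE /=.
  have v0 : v = 0 by apply/eqP; rewrite -sqrf_eq0 uv u1 subrr mul0r.
  case: (unliftP ord0 j) => [i|] ->; last by rewrite eqxx -/u u1.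
  by rewrite (ord1 i) -/v v0.
have u2 : (1 - u) * (1 + u) >= 0 by rewrite -uv sqr_ge0.
have ult1 : u < 1 by rewrite lt_neqAle u1 /=; nra.
set s := Num.sqrt (2 * (1 - u)) in yitv *.
have s0 : 0 < s by rewrite sqrtr_gt0; lra.
have s2 : s ^+ 2 = 2 * (1 - u) by rewrite sqr_sqrtr; lra.
apply: val_inj; apply/rowP => j /=; rewrite mxE clamp01_id //.
have -> : (1 - v / s) / 2 * (1 - (1 - v / s) / 2) = (s / 4) ^+ 2.
  have -> : (1 - v / s) / 2 * (1 - (1 - v / s) / 2) = (1 - v ^+ 2 / s ^+ 2) / 4.
    by field; rewrite gt_eqF.
  by rewrite uv expr_div_n s2; field; apply/eqP; lra.
rewrite sqrtr_sqr ger0_norm; last by rewrite divr_ge0 // ltW.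
case: (unliftP ord0 j) => [i|] -> /=; last first.
  by rewrite expr_div_n s2; change (1 - 8 * (2 * (1 - u) / 4 ^+ 2) = u); field.
rewrite (ord1 i).
by change (4 * (s / 4) * (1 - 2 * ((1 - v / s) / 2)) = v); field; rewrite gt_eqF.
Qed.

Lemma loopK c : 0 < c < 1 -> angle (loop c) = c.
Proof.
move=> /andP[c0 c1]; rewrite /angle /= !mxE /= clamp01_id ?(ltW c0) ?(ltW c1) //.
have q0 : 0 < c * (1 - c) by rewrite mulr_gt0 // subr_gt0.
rewrite ifF; last by apply/negbTE/eqP; lra.
have -> : Num.sqrt (2 * (1 - (1 - 8 * (c * (1 - c)))))
          = 4 * Num.sqrt (c * (1 - c)).
  have -> : 2 * (1 - (1 - 8 * (c * (1 - c)))) = 4 ^+ 2 * (c * (1 - c)) by ring.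
  by rewrite (sqrtrM _ (sqr_ge0 4)) sqrtr_sqr ger0_norm.
have s0 : Num.sqrt (c * (1 - c)) != 0 by rewrite gt_eqF // sqrtr_gt0.
by field.
Qed.

Lemma circle_hausdorff : hausdorff_space circle.
Proof. apply: hausdorff_set_type; exact: norm_hausdorff. Qed.

End Circle.

Section WedgeOfCircles.
Variables (R : realType) (m : nat).
Local Notation W := (wedge_spheres R m 1).

Definition petal (t : 'I_m) (c : R) : W :=
  wedge_lift (fun _ : 'I_m => sphere_pole R 1) (i := t) (loop c).

Lemma petal_continuous t : continuous (petal t).
Proof.
move=> c; apply: (@continuous_comp _ _ _ (@loop R)); first exact: loop_continuous.
exact: wedge_lift_continuous.
Qed.

Lemma petal_base t t' c c' :
  loop c = sphere_pole R 1 -> loop c' = sphere_pole R 1 -> petal t c = petal t' c'.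
Proof.
rewrite /petal => -> ->.
exact: (@wedge_liftE _ (fun=> _) (fun _ : 'I_m => sphere_pole R 1) t'
  (sphere_pole R 1) t (sphere_pole R 1)).
Qed.

Lemma petal_surj (w : W) : exists t, exists2 c, 0 <= c <= 1 & petal t c = w.
Proof.
have := wedgeTE (fun _ : 'I_m => sphere_pole R 1).
move/seteqP => [_ /(_ w I) [t _ [z _ <-]]].
by exists t, (angle z); [exact: angle_itv|rewrite /petal angleK].
Qed.

(** The maps [(c, s) |-> (petal t c, s)] from the unit square jointly present the
    product of the wedge with [0, 1] as a quotient; a family of maps on squares
    that is compatible at the base point descends to it. *)
Lemma wedge_homotopy (Z : topologicalType) (psi : 'I_m -> R * R -> Z) :
  (forall t, continuous (psi t)) ->
  (forall t t' s, 0 <= s <= 1 -> psi t (0, s) = psi t' (0, s)) ->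
  (forall t s, 0 <= s <= 1 -> psi t (1, s) = psi t (0, s)) ->
  exists phi : W * R -> Z, {within [set: W] `*` `[0, 1], continuous phi} /\
    forall t c s, 0 <= c <= 1 -> 0 <= s <= 1 -> phi (petal t c, s) = psi t (c, s).
Proof.
move=> cpsi psi0 psi1.
pose phi (z : W * R) :=
  @wedge_fun _ (fun=> _) (fun _ : 'I_m => sphere_pole R 1) Z
    (fun t x => psi t (angle x, z.2)) z.1.
have phiE t c s : 0 <= c <= 1 -> 0 <= s <= 1 -> phi (petal t c, s) = psi t (c, s).
  move=> c01 s01; rewrite /phi /petal wedge_lift_funE /=; last first.
    by move=> i j; rewrite angle_pole; exact: psi0.
  move: (c01) => /andP[]; rewrite !le_eqVlt.
  case/predU1P => [<- _|c0]; first by rewrite loop_le0 // angle_pole.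
  case/predU1P => [->|c1]; first by rewrite loop_ge1 // angle_pole psi1.
  by rewrite loopK // c0.
exists phi; split=> //.
pose q (t : 'I_m) (z : R * R) : W * R := (petal t z.1, z.2).
pose I01 : set R := [set` `[0, 1]].
apply: (@quotient_within (R * R)%type (W * R)%type Z 'I_m (I01 `*` I01)
  ([set: W] `*` I01) q psi phi) => //.
- by apply: compact_setX; exact: segment_compact.
- apply: hausdorff_prod; last exact: Rhausdorff.
  by apply: wedge_hausdorff => _; exact: circle_hausdorff.
- move=> t; apply: pair_continuous; last by move=> z; exact: cvg_snd.
  move=> z; apply: (@continuous_comp _ _ _ fst (petal t)); first exact: cvg_fst.
  exact: petal_continuous.
- by move=> t [c s] [_ /= s01].
- move=> [w s] [_ /= s01]; have [t [c c01 cw]] := petal_surj w.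
  by exists t, (c, s); [split|rewrite /q /= cw].
- by move=> t [c s] [/= c01 s01]; rewrite phiE.
Qed.

End WedgeOfCircles.

(** * Maps into the realization of a complex *)

Section Realization.
Variables (R : realType) (n : nat) (K : simplicial_complex 'I_n).
Local Notation X := (realization R K).

Lemma barycentric_continuous i : continuous (fun x : X => \val x ord0 i).
Proof.
move=> x; apply: (@continuous_comp _ _ _ (set_val : X -> 'rV[R]_n)
  (fun y : 'rV[R]_n => y ord0 i)).
  exact: initial_continuous.
exact: coord_continuous.
Qed.

Lemma realization_continuous (Y : topologicalType) (f : Y -> X) :
  (forall i, continuous (fun y => \val (f y) ord0 i)) -> continuous f.
Proof.
move=> cf; apply: continuous_comp_initial; apply: continuous_mx => i j.
by rewrite (ord1 i); exact: cf.
Qed.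

Lemma barycentricP (x : X) :
  [/\ forall i, 0 <= \val x ord0 i, \sum_i \val x ord0 i = 1
    & faces K [set i : 'I_n | \val x ord0 i != 0]%SET].
Proof. exact: (set_valP x). Qed.

Lemma barycentric_intro (y : 'rV[R]_n) (s : {set 'I_n}) :
  (forall i, 0 <= y ord0 i) -> \sum_i y ord0 i = 1 -> faces K s ->
  (forall i, y ord0 i != 0 -> i \in s) -> y \in @barycentric_points R n K.
Proof.
move=> y0 y1 Ks ys; rewrite inE; split=> //; apply: (faces_sub Ks).
  by apply/fintype.subsetP => i; rewrite inE; exact: ys.
apply/set0Pn; have [i yi|y00] := pickP (fun i => y ord0 i != 0).
  by exists i; rewrite inE.
suff s0 : \sum_i y ord0 i = 0 by move/eqP: y1; rewrite s0 eq_sym oner_eq0.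
by apply: big1 => i _; apply/eqP; have /negbFE := y00 i.
Qed.

(** If f y and g y lie in a common simplex, so does the segment between them. *)
Lemma homotopic_straight_line (Y : topologicalType) (f g : Y -> X) :
  continuous f -> continuous g ->
  (forall y, exists2 s, faces K s & forall i,
     (\val (f y) ord0 i != 0) || (\val (g y) ord0 i != 0) -> i \in s) ->
  homotopic R f g.
Proof.
move=> cf cg fg.
pose h (z : Y * R) : 'rV[R]_n :=
  (1 - clamp01 z.2) *: \val (f z.1) + clamp01 z.2 *: \val (g z.1).
have hX z : h z \in @barycentric_points R n K.
  have [s Ks fgs] := fg z.1; have /andP[c0 c1] := clamp01_itv z.2.
  have [f0 f1 _] := barycentricP (f z.1); have [g0 g1 _] := barycentricP (g z.1).
  apply: (barycentric_intro (s := s)) => // [i||i]; rewrite ?mxE.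
  - by rewrite addr_ge0 // mulr_ge0 // subr_ge0.
  - under eq_bigr do rewrite !mxE.
    by rewrite big_split -!mulr_sumr /= f1 g1 !mulr1 subrK.
  - apply: contraR => /(contra (fgs i)).
    rewrite negb_or !negbK => /andP[/eqP -> /eqP ->].
    by rewrite !mulr0 addr0.
apply/homotopicP; exists (fun z => exist _ (h z) (hX z)); split=> [|y|y].
- apply: realization_continuous => i /=; under eq_fun do rewrite !mxE.
  have cc (a : R) : continuous (fun _ : Y * R => a) by exact: cst_continuous.
  have cs : continuous (fun z : Y * R => clamp01 z.2).
    by apply: continuous_clamp01 => z; exact: cvg_snd.
  have c1 (u : Y -> X) :
      continuous u -> continuous (fun z : Y * R => \val (u z.1) ord0 i).
    move=> cu z; apply: (@continuous_comp _ _ _ fst (fun y => \val (u y) ord0 i)).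
      exact: cvg_fst.
    by apply: (@continuous_comp _ _ _ u (fun x : X => \val x ord0 i));
      [exact: cu|exact: barycentric_continuous].
  apply: continuous_addr; apply: continuous_mulr => //; do ?exact: c1.
  exact: continuous_subr.
- by apply: val_inj; rewrite /= /h /= clamp01_le0 // subr0 scale1r scale0r addr0.
- by apply: val_inj; rewrite /= /h /= clamp01_ge1 // subrr scale1r scale0r add0r.
Qed.

End Realization.

(** * Piecewise linear arcs *)

Section Arc.
Variables (R : realType) (n : nat).

Definition vtx (j : nat) : 'rV[R]_n := \row_i (i == j :> nat)%:R.

Definition seg (a b : nat) (y : R) : 'rV[R]_n := (1 - y) *: vtx a + y *: vtx b.

Lemma seg0 a b : seg a b 0 = vtx a.
Proof. by rewrite /seg subr0 scale1r scale0r addr0. Qed.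

Lemma seg1 a b : seg a b 1 = vtx b.
Proof. by rewrite /seg subrr scale1r scale0r add0r. Qed.

(** The path through the vertices 0, ..., N that is at vertex j at time j and rests
    at its end points outside [0, N].  As a sum of clamped increments it is
    visibly continuous. *)
Definition polyline (N : nat) (p : R) : 'rV[R]_n :=
  vtx 0 + \sum_(j < N) clamp01 (p - j%:R) *: (vtx j.+1 - vtx j).

Lemma polylineS N p :
  polyline N.+1 p = polyline N p + clamp01 (p - N%:R) *: (vtx N.+1 - vtx N).
Proof. by rewrite /polyline big_ord_recr addrA. Qed.

Lemma polyline_ge N p : N%:R <= p -> polyline N p = vtx N.
Proof.
elim: N => [|N IH] Np; first by rewrite /polyline big_ord0 addr0.
have NN : (N.+1%:R : R) = N%:R + 1 by rewrite -natr1.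
rewrite polylineS IH; last by lra.
by rewrite clamp01_ge1; [rewrite scale1r addrC subrK|lra].
Qed.

Lemma polyline_seg N j y : (j < N)%N -> 0 <= y <= 1 ->
  polyline N (j%:R + y) = seg j j.+1 y.
Proof.
move=> + y01; elim: N => // N IH; rewrite ltnS leq_eqVlt => /predU1P[<-|jN].
  rewrite polylineS polyline_ge; last by rewrite lerDl; case/andP: y01.
  rewrite addrAC subrr add0r clamp01_id // /seg scalerBr scalerBl scale1r.
  by rewrite [in RHS]addrAC -addrA.
rewrite polylineS (IH jN) clamp01_le0 ?scale0r ?addr0 //.
have : j.+1%:R <= N%:R :> R by rewrite ler_nat.
by rewrite -natr1; lra.
Qed.

Lemma polyline_le0 N p : p <= 0 -> polyline N p = vtx 0.
Proof.
move=> p0; rewrite /polyline big1 ?addr0 // => j _.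
rewrite clamp01_le0 ?scale0r //; have : 0 <= j%:R :> R by exact: ler0n.
by lra.
Qed.

Lemma polyline_nat N j : (j <= N)%N -> polyline N j%:R = vtx j.
Proof.
rewrite leq_eqVlt => /predU1P[<-|jN]; first exact: polyline_ge.
by rewrite -[j%:R]addr0 polyline_seg ?lexx ?ler01 // seg0.
Qed.

Lemma polyline_on_seg N p :
  exists j y, [/\ (j <= N)%N, 0 <= y <= 1 & polyline N.+1 p = seg j j.+1 y].
Proof.
elim: N => [|N [j [y [jN y01 E]]]].
  have [p0|p0] := leP p 0; last first.
    have [p1|p1] := leP p 1; last first.
      exists 0%N, 1; rewrite lexx ler01 seg1; split=> //.
      by rewrite polyline_ge //; exact: ltW.
    have p01 : 0 <= p <= 1 by rewrite (ltW p0).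
    by exists 0%N, p; rewrite -(@polyline_seg 1 0 p) // add0r.
  by exists 0%N, 0; rewrite polyline_le0 // seg0 lexx ler01.
have [pN|pN] := leP p N.+1%:R.
  exists j, y; split=> //; first exact: leqW.
  by rewrite polylineS -E clamp01_le0 ?scale0r ?addr0 // subr_le0.
exists N.+1, (clamp01 (p - N.+1%:R)); split; [by []|exact: clamp01_itv|].
rewrite polylineS polyline_ge; last exact: ltW.
by rewrite /seg scalerBr scalerBl scale1r [in RHS]addrAC -addrA.
Qed.

Lemma polyline_coord_continuous N i : continuous (fun p : R => polyline N p ord0 i).
Proof.
have cc (a : R) : continuous (fun _ : R => a) by exact: cst_continuous.
under eq_fun do rewrite /polyline mxE summxE.
apply: continuous_addr => //; apply: continuous_sumr => j.
under eq_fun do rewrite !mxE.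
apply: continuous_mulr => //; apply: continuous_clamp01.
by apply: continuous_subr => // ?; exact: cvg_id.
Qed.

End Arc.

(** * The avalanche complex *)

(** A vertex carries at most one grain at any time, so each grain moves one step
    further at each time. *)
Lemma firing_set_initial (n k t : nat) :
  firing_set (config_at (initial_config n k) t) =
  [set i : 'I_n | (nat_of_ord i \in [:: t; t.+1; t + k.+2])%N]%SET.
Proof.
suff -> : config_at (initial_config n k) t =
    [ffun i : 'I_n => (nat_of_ord i \in [:: t; t.+1; t + k.+2])%N : nat].
  by apply/finset.setP => i; rewrite !inE ffunE lt0b !inE.
elim: t => [//|t IH]; rewrite /config_at iterS -/(config_at _ _) IH.
apply/ffunP => i; rewrite !ffunE !inE ffunE lt0b !inE subnn add0n; congr nat_of_bool.
apply/existsP/idP => [[j]|it].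
  by rewrite !inE !ffunE !inE lt0b => /andP[/eqP <-]; rewrite eqSS addSn eqSS.
have i0 : (i.-1 < n)%N by apply: leq_ltn_trans (leq_pred _) (ltn_ord i).
have ip : i.-1.+1 = i :> nat by rewrite prednK //; move: it; lia.
exists (Ordinal i0); rewrite !inE !ffunE !inE lt0b /= ip eqxx /=.
by move: it; rewrite -ip !addSn !eqSS.
Qed.

Section Coordinates.
Variables (R : realType) (n : nat).
Implicit Types y : 'rV[R]_n.

(** Indexing by natural numbers, with 0 beyond the end of the vector, lets the
    facets that are cut off at the end of the path be treated like the others. *)
Definition entry y (j : nat) : R := \sum_i y ord0 i * (i == j :> nat)%:R.

Lemma entry_ord y (i : 'I_n) : entry y i = y ord0 i.
Proof.
rewrite /entry (bigD1 i) //= eqxx mulr1 big1 ?addr0 // => l li.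
by rewrite (inj_eq val_inj) (negbTE li) mulr0.
Qed.

Lemma entry_neq0 y j : entry y j != 0 ->
  exists2 i : 'I_n, i = j :> nat & y ord0 i != 0.
Proof.
have [jn|jn] := ltnP j n.
  by rewrite (entry_ord y (Ordinal jn)) => y0; exists (Ordinal jn).
rewrite /entry big1 ?eqxx // => i _; rewrite ltn_eqF ?mulr0 //.
exact: leq_trans (ltn_ord i) jn.
Qed.

Lemma entry_seg a b (u : R) j : (a < n)%N -> (b < n)%N ->
  entry (seg n a b u) j = (1 - u) * (a == j)%:R + u * (b == j)%:R.
Proof.
move=> an bn; have [jn|jn] := ltnP j n.
  by rewrite (entry_ord _ (Ordinal jn)) !mxE /= !(eq_sym j).
rewrite (ltn_eqF (leq_trans an jn)) (ltn_eqF (leq_trans bn jn)) !mulr0 addr0.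
apply/eqP/negPn/negP => /entry_neq0[i ij _].
by have := ltn_ord i; rewrite ij ltnNge jn.
Qed.

Lemma segE a b (u : R) i :
  seg n a b u ord0 i = (1 - u) * (i == a :> nat)%:R + u * (i == b :> nat)%:R.
Proof. by rewrite !mxE. Qed.

Lemma seg_ge0 a b (u : R) i : 0 <= u <= 1 -> 0 <= seg n a b u ord0 i.
Proof.
by move=> /andP[u0 u1]; rewrite segE addr_ge0 // mulr_ge0 ?ler0n // subr_ge0.
Qed.

Lemma seg_neq0 a b (u : R) i :
  seg n a b u ord0 i != 0 -> nat_of_ord i \in [:: a; b].
Proof.
apply: contraR; rewrite !inE negb_or segE => /andP[/negbTE -> /negbTE ->].
by rewrite !mulr0 addr0.
Qed.

Lemma sum_seg a b (u : R) : (a < n)%N -> (b < n)%N ->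
  \sum_i seg n a b u ord0 i = 1.
Proof.
have delta1 c : (c < n)%N -> \sum_(i < n) (i == c :> nat)%:R = 1 :> R.
  move=> cn; rewrite (bigD1 (Ordinal cn)) //= eqxx big1 ?addr0 // => i.
  by rewrite -(inj_eq val_inj) => /negbTE ->.
move=> an bn; under eq_bigr do rewrite segE.
by rewrite big_split -!mulr_sumr /= !delta1 // !mulr1 subrK.
Qed.

Lemma entry_continuous_comp (Y : topologicalType) (f : Y -> 'rV[R]_n) j :
  (forall i, continuous (fun z => f z ord0 i)) ->
  continuous (fun z => entry (f z) j).
Proof.
move=> cf; apply: continuous_sumr => i; apply: continuous_mulr => //.
exact: cst_continuous.
Qed.

Variable k : nat.

Definition in_facet y t :=
  forall i, y ord0 i != 0 -> nat_of_ord i \in [:: t; t.+1; t + k.+2].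

Definition in_edge y t :=
  forall i, y ord0 i != 0 -> nat_of_ord i \in [:: t; t.+1].

(** A point of the complex satisfies this exactly when it lies in the triangle t
    and off the spine: its support then contains a long edge, {t, t+k+2} or
    {t+1, t+k+2}. *)
Definition active y t :=
  (entry y (t + k.+2) != 0) && ((entry y t != 0) || (entry y t.+1 != 0)).

Lemma in_edge_facet y t : in_edge y t -> in_facet y t.
Proof. by move=> yt i /yt; rewrite !inE orbA => ->. Qed.

Lemma in_facet_edge y t : (n <= t + k.+2)%N -> in_facet y t -> in_edge y t.
Proof.
move=> nt yt i /yt; rewrite !inE orbA => /orP[//|/eqP it].
by have := ltn_ord i; rewrite it ltnNge nt.
Qed.

Lemma in_facet_entry y t j :
  in_facet y t -> entry y j != 0 -> j \in [:: t; t.+1; t + k.+2].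
Proof. by move=> yt /entry_neq0[i <-]; exact: yt. Qed.

Lemma inactive_entry y t : ~~ active y t ->
  entry y (t + k.+2) = 0 \/ entry y t = 0 /\ entry y t.+1 = 0.
Proof.
by rewrite negb_and negb_or !negbK => /orP[/eqP|/andP[/eqP ? /eqP]]; [left|right].
Qed.

Lemma sum_facet y t (F : nat -> R) : in_facet y t ->
  \sum_(i < n) F i * y ord0 i =
  F t * entry y t + F t.+1 * entry y t.+1 + F (t + k.+2)%N * entry y (t + k.+2).
Proof.
move=> yt; rewrite /entry !mulr_sumr -!big_split /=; apply: eq_bigr => i _.
have [->|/yt] := eqVneq (y ord0 i) 0; first by rewrite !(mul0r, mulr0) !addr0.
have tt : (t == t.+1) = false by lia.
have tk : (t == t + k.+2) = false by lia.
have tk1 : (t.+1 == t + k.+2) = false by lia.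
by rewrite !inE => /or3P[]/eqP ->; rewrite ?eqxx ?tt ?tk ?tk1 ?(eq_sym _ t) ?tt
  ?tk ?(eq_sym _ t.+1) ?tk1 !(mulr0, mulr1, addr0, add0r).
Qed.

Hypothesis hk : (1 <= k)%N.

(** The differences k+2 and k+1 of the two ends of a long edge occur in a facet
    only at its last vertex, and the pair determines the facet; this uses
    k+1 > 1. *)
Lemma active_unique y t u : in_facet y t -> active y u -> u = t.
Proof.
move=> yt /andP[/(in_facet_entry yt) + /orP[]/(in_facet_entry yt)];
  rewrite !inE; lia.
Qed.

Lemma in_edge_inactive y t u : in_edge y t -> ~~ active y u.
Proof.
move=> yt; have yc j : entry y j != 0 -> j \in [:: t; t.+1].
  by move=> /entry_neq0[i <-]; exact: yt.
by apply/negP => /andP[/yc + /orP[]/yc]; rewrite !inE; lia.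
Qed.

End Coordinates.

(** * The homotopy equivalence *)

Section Avalanche.
Variables (R : realType) (k n : nat).
Hypotheses (hk : (1 <= k)%N) (hn : (k + 3 <= n)%N).
Local Notation K := (avalanche_complex (initial_config n k)).
Local Notation X := (realization R K).
Local Notation m := (n - k - 2)%N.
Local Notation W := (wedge_spheres R m 1).
Local Notation vtx := (vtx R n).
Local Notation seg := (@seg R n).

Lemma apex_lt (t : 'I_m) : (t + k.+2 < n)%N.
Proof. by have := ltn_ord t; lia. Qed.

Lemma faces_facet t : (t < n)%N ->
  faces K [set i : 'I_n | (nat_of_ord i \in [:: t; t.+1; t + k.+2])%N]%SET.
Proof.
move=> tn; split.
  by apply/set0Pn; exists (Ordinal tn); rewrite !inE eqxx.
exists (firing_set (config_at (initial_config n k) t)); first by exists t.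
by rewrite firing_set_initial.
Qed.

Lemma point_in_facet (x : X) : exists t : 'I_n, in_facet k (\val x) t.
Proof.
have [_ _ [/set0Pn[i]]] := barycentricP x; rewrite inE => xi.
move=> [_ [t _ <-] /fintype.subsetP sub].
have xt : in_facet k (\val x) t.
  by move=> l xl; have := sub l; rewrite firing_set_initial !inE; exact.
have tn : (t < n)%N.
  by have := xt i xi; have := ltn_ord i; rewrite !inE; lia.
by exists (Ordinal tn).
Qed.

Lemma seg_point a b t (u : R) : (t < n)%N -> (a < n)%N -> (b < n)%N ->
  a \in [:: t; t.+1; t + k.+2]%N -> b \in [:: t; t.+1; t + k.+2]%N ->
  0 <= u <= 1 -> seg a b u \in @barycentric_points R n K.
Proof.
move=> tn an bn at_ bt u01.
apply: (barycentric_intro (s := [set i : 'I_n |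
  (nat_of_ord i \in [:: t; t.+1; t + k.+2])%N]%SET)).
- by move=> i; exact: seg_ge0.
- exact: sum_seg.
- exact: faces_facet.
- by move=> i /seg_neq0; rewrite inE !inE => /orP[]/eqP ->;
    [move: at_|move: bt]; rewrite !inE.
Qed.

(** The length n-1, as a successor: a point of the spine then always lies on one
    of its segments. *)
Definition spine_row (p : R) : 'rV[R]_n := polyline n n.-2.+1 p.

Lemma spine_on_seg p :
  exists j y, [/\ (j.+1 < n)%N, 0 <= y <= 1 & spine_row p = seg j j.+1 y].
Proof.
have [j [y [jn y01 E]]] := @polyline_on_seg R n n.-2 p.
by exists j, y; split=> //; lia.
Qed.

Lemma spine_seg j y : (j.+1 < n)%N -> 0 <= y <= 1 ->
  spine_row (j%:R + y) = seg j j.+1 y.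
Proof. by move=> jn; apply: polyline_seg; lia. Qed.

Lemma spine_nat j : (j < n)%N -> spine_row j%:R = vtx j.
Proof. by move=> jn; apply: polyline_nat; lia. Qed.

Lemma spine_point p : spine_row p \in @barycentric_points R n K.
Proof.
have [j [y [jn y01 ->]]] := spine_on_seg p.
by apply: (@seg_point _ _ j) => //; rewrite ?inE ?eqxx ?orbT //; exact: ltnW.
Qed.

Definition spine (p : R) : X := exist _ (spine_row p) (spine_point p).

Lemma spine_in_edge p : exists t, in_edge (\val (spine p)) t.
Proof.
have [j [y [jn y01 E]]] := spine_on_seg p.
by exists j => i /=; rewrite E => /seg_neq0.
Qed.

Lemma spine_continuous : continuous spine.
Proof. by apply: realization_continuous => i; exact: polyline_coord_continuous. Qed.

Definition len (t : nat) : R := (t.*2 + k + 4)%:R.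

(** Three successive increments: up the spine to t+1, across to t+k+2 during
    [t+1, t+2], and back down the spine, reaching 0 at time [len t].  Each of
    them is constant while another one varies. *)
Definition lasso_row (t : nat) (p : R) : 'rV[R]_n :=
  spine_row (Num.min p t.+1%:R)
  + clamp01 (p - t.+1%:R) *: (vtx (t + k.+2) - vtx t.+1)
  + (spine_row (Num.min (t + k.+2)%:R (len t - p)) - vtx (t + k.+2)).

Lemma lenE t : len t = t.+1%:R + 1 + (t + k.+2)%:R.
Proof. by rewrite /len natr1 -natrD; congr _%:R; lia. Qed.

Lemma lasso_row_lo (t : 'I_m) p : p <= t.+1%:R -> lasso_row t p = spine_row p.
Proof.
move=> pt; rewrite /lasso_row min_l // clamp01_le0 ?subr_le0 // scale0r addr0.
rewrite min_l; first by rewrite (spine_nat (apex_lt t)) subrr addr0.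
by rewrite lenE; lra.
Qed.

Lemma lasso_row_mid (t : 'I_m) c : 0 <= c <= 1 ->
  lasso_row t (t.+1%:R + c) = seg t.+1 (t + k.+2) c.
Proof.
move=> /[dup] c01 /andP[c0 c1]; rewrite /lasso_row min_r; last by lra.
have -> : t.+1%:R + c - t.+1%:R = c by rewrite addrAC subrr add0r.
rewrite clamp01_id // min_l; last by rewrite lenE; lra.
have t1n : (t.+1 < n)%N by have := apex_lt t; lia.
rewrite (spine_nat (apex_lt t)) subrr addr0 (spine_nat t1n).
by rewrite /seg scalerBr scalerBl scale1r [in RHS]addrAC -addrA.
Qed.

Lemma lasso_row_hi (t : 'I_m) p : t.+1%:R + 1 <= p ->
  lasso_row t p = spine_row (len t - p).
Proof.
move=> pt; rewrite /lasso_row min_r; last by lra.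
rewrite clamp01_ge1 ?scale1r; last by lra.
have t1n : (t.+1 < n)%N by have := apex_lt t; lia.
rewrite min_r; last by rewrite lenE; lra.
by rewrite (spine_nat t1n) [vtx t.+1 + _]addrC subrK [LHS]addrC subrK.
Qed.

Lemma lasso_cases (t : 'I_m) (p : R) :
  [\/ p <= t.+1%:R, t.+1%:R + 1 <= p |
      exists2 c : R, 0 <= c <= 1 & p = t.+1%:R + c].
Proof.
have [pt|pt] := leP p t.+1%:R; first by constructor 1.
have [pt1|pt1] := leP (t.+1%:R + 1) p; first by constructor 2.
constructor 3; exists (p - t.+1%:R); last by rewrite addrC subrK.
by apply/andP; split; lra.
Qed.

Lemma lasso_point (t : 'I_m) p : lasso_row t p \in @barycentric_points R n K.
Proof.
have [pt|pt|[c c01 ->]] := lasso_cases t p.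
- by rewrite lasso_row_lo //; exact: spine_point.
- by rewrite lasso_row_hi //; exact: spine_point.
have tn := apex_lt t; rewrite lasso_row_mid //.
by apply: (@seg_point _ _ t) => //; rewrite ?inE ?eqxx ?orbT //; lia.
Qed.

Definition lasso (t : 'I_m) (p : R) : X :=
  exist _ (lasso_row t p) (lasso_point t p).

Lemma lasso_lo (t : 'I_m) p : p <= t.+1%:R -> lasso t p = spine p.
Proof. by move=> pt; apply: val_inj; exact: lasso_row_lo. Qed.

Lemma lasso_hi (t : 'I_m) p : t.+1%:R + 1 <= p -> lasso t p = spine (len t - p).
Proof. by move=> pt; apply: val_inj; exact: lasso_row_hi. Qed.

Lemma lasso_continuous t : continuous (lasso t).
Proof.
apply: realization_continuous => i /=.
have cc (a : R) : continuous (fun _ : R => a) by exact: cst_continuous.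
have ci : continuous (fun p : R => p) by move=> ?; exact: cvg_id.
have cs (h : R -> R) : continuous h -> continuous (fun p => spine_row (h p) ord0 i).
  move=> ch p; apply: (@continuous_comp _ _ _ h (fun p => spine_row p ord0 i)).
    exact: ch.
  exact: polyline_coord_continuous.
have combE (u v w z : 'rV[R]_n) c :
    (u + c *: v + (w - z)) ord0 i = u ord0 i + c * v ord0 i + (w ord0 i - z ord0 i).
  by rewrite !mxE.
under eq_fun do rewrite combE.
apply: continuous_addr; first apply: continuous_addr.
- by apply: cs; exact: continuous_minr.
- by apply: continuous_mulr => //; apply: continuous_clamp01; exact: continuous_subr.
- apply: continuous_subr => //.
  by apply: cs; apply: continuous_minr => //; exact: continuous_subr.
Qed.

Section Glue.
Variables (Y Z : topologicalType) (pr : Y -> X).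
Variables (A : 'I_m -> Y -> Z) (B : Y -> Z).
Hypotheses (cpr : continuous pr) (cA : forall t, continuous (A t))
  (cB : continuous B).
Hypothesis AB : forall (t : 'I_m) y, in_facet k (\val (pr y)) t ->
  ~~ active k (\val (pr y)) t -> A t y = B y.

(** The map that is [A t] on the triangle t and [B] on the spine.  A point off the
    spine is active for exactly one t, so no choice is involved. *)
Definition glue (y : Y) : Z :=
  if [pick t : 'I_m | active k (\val (pr y)) t] is Some t then A t y else B y.

Lemma glue_facet (t : 'I_m) y : in_facet k (\val (pr y)) t -> glue y = A t y.
Proof.
move=> yt; rewrite /glue; case: pickP => [u yu|inact].
  by have /val_inj -> := active_unique hk yt yu.
by rewrite AB // inact.
Qed.

Lemma glue_edge t y : in_edge (\val (pr y)) t -> glue y = B y.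
Proof.
move=> yt; rewrite /glue; case: pickP => // u.
by rewrite (negbTE (in_edge_inactive hk _ yt)).
Qed.

Lemma glue_continuous : continuous glue.
Proof.
pose C (t : 'I_n) := [set y : Y | in_facet k (\val (pr y)) t].
pose F (t : 'I_n) :=
  if insub (nat_of_ord t) : option 'I_m is Some u then A u else B.
apply: (@continuous_closed_cover _ _ _ C F) => [t|y|t|t y yt].
- have -> : C t = \bigcap_(i in [set i : 'I_n |
        nat_of_ord i \notin [:: t : nat; t.+1; t + k.+2]%N])
      [set y | \val (pr y) ord0 i = 0].
    apply/seteqP; split=> y yt i.
      by move=> /= it; apply/eqP; apply: contraNT it; exact: yt.
    by apply: contraR => it; apply/eqP; exact: yt.
  apply: closed_bigI => i _.
  have : continuous (fun y => \val (pr y) ord0 i).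
    move=> y; apply: (@continuous_comp _ _ _ pr (fun x : X => \val x ord0 i)).
      exact: cpr.
    exact: barycentric_continuous.
  move=> /continuous_closedP/(_ [set 0]); apply.
  exact: accessible_closed_set1 (hausdorff_accessible (@Rhausdorff R)) _.
- by have [t yt] := point_in_facet (pr y); exists t.
- by rewrite /F; case: insub.
- rewrite /F; case: insubP => [u _ ut|tm].
    by apply: glue_facet; rewrite ut.
  apply: (@glue_edge t); apply: in_facet_edge yt.
  by move: tm; lia.
Qed.

End Glue.

Lemma petals_gt0 : (0 < m)%N.
Proof. by move: hn; lia. Qed.

Definition base : W := petal (Ordinal petals_gt0) 0.

Lemma petal_le0 (t : 'I_m) c : c <= 0 -> petal t c = base.
Proof. by move=> c0; apply: petal_base; exact: loop_le0. Qed.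

Lemma petal_ge1 (t : 'I_m) c : 1 <= c -> petal t c = base.
Proof. by move=> c1; apply: petal_base; [exact: loop_ge1|exact: loop_le0]. Qed.

(** The collapse of the triangle t from its free edge moves a point parallel to
    the line joining the midpoint of that edge to t+1, along which this number is
    constant. *)
Definition height (t : nat) (x : X) : R :=
  entry (\val x) (t + k.+2) - entry (\val x) t.

(** On the spine this is the parameter of the point, by which the contraction of
    the spine to the vertex 0 is linear. *)
Definition position (x : X) : R := \sum_(i < n) i%:R * \val x ord0 i.

Lemma height_continuous t : continuous (height t).
Proof.
by apply: continuous_subr; apply: entry_continuous_comp => i;
  exact: barycentric_continuous.
Qed.

Lemma position_continuous : continuous position.
Proof.
apply: continuous_sumr => i; apply: continuous_mulr; first exact: cst_continuous.
exact: barycentric_continuous.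
Qed.

Lemma entry_ge0 (x : X) j : 0 <= entry (\val x) j.
Proof.
by have [x0 _ _] := barycentricP x; apply: sumr_ge0 => i _; rewrite mulr_ge0.
Qed.

Lemma entry_sum (x : X) t : in_facet k (\val x) t ->
  entry (\val x) t + entry (\val x) t.+1 + entry (\val x) (t + k.+2) = 1.
Proof.
move=> /(sum_facet (fun=> 1)); have [_ x1 _] := barycentricP x.
by rewrite !mul1r => <-; under eq_bigr do rewrite mul1r.
Qed.

(** The part of the triangle t on the spine is its edge {t, t+1} and its apex
    t+k+2, which are the two ends of the crossing of the lasso. *)
Lemma height_inactive (x : X) t :
  in_facet k (\val x) t -> ~~ active k (\val x) t ->
  (height t x <= 0 /\ position x = t.+1%:R + height t x) \/
  (height t x = 1 /\ position x = (t + k.+2)%:R).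
Proof.
move=> xt; have := sum_facet (fun i => i%:R) xt; rewrite -/(position x).
have := entry_sum xt; have a0 := entry_ge0 x t.
move=> s1 -> /inactive_entry[c0|[a1 b1]]; [left|right]; rewrite /height.
  move: s1; rewrite c0 -natr1 => s1; split; first by lra.
  by rewrite (_ : entry _ t.+1 = 1 - entry (\val x) t); [ring|lra].
by move: s1; rewrite a1 b1 !mulr0 !add0r => ->; rewrite mulr1 subr0.
Qed.

(** The map to the wedge: it contracts the spine, and each triangle onto its
    loop. *)
Definition crush : X -> W :=
  glue id (fun t x => petal t (height t x)) (fun=> base).

Lemma crush_compat (t : 'I_m) (x : X) : in_facet k (\val x) t ->
  ~~ active k (\val x) t -> petal t (height t x) = base.
Proof.
move=> xt /(height_inactive xt)[[h0 _]|[h1 _]]; first exact: petal_le0.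
by rewrite petal_ge1 ?h1.
Qed.

Lemma crush_facet (t : 'I_m) x : in_facet k (\val x) t ->
  crush x = petal t (height t x).
Proof. by apply: glue_facet; exact: crush_compat. Qed.

Lemma crush_edge t (x : X) : in_edge (\val x) t -> crush x = base.
Proof. exact: glue_edge. Qed.

Lemma crush_continuous : continuous crush.
Proof.
apply: glue_continuous => [x|t x||]; last exact: crush_compat.
- exact: cvg_id.
- apply: (@continuous_comp _ _ _ (height t)); first exact: height_continuous.
  exact: petal_continuous.
- exact: cst_continuous.
Qed.

Lemma crush_spine p : crush (spine p) = base.
Proof. by have [t /crush_edge] := spine_in_edge p. Qed.

(** Only the crossing of the lasso is seen by [crush]. *)
Lemma crush_lasso (t : 'I_m) p : crush (lasso t p) = petal t (p - t.+1%:R).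
Proof.
have [pt|pt|[c c01 ->]] := lasso_cases t p.
- by rewrite lasso_lo // crush_spine petal_le0 // subr_le0.
- by rewrite lasso_hi // crush_spine petal_ge1 //; lra.
have tn := apex_lt t; have t1n : (t.+1 < n)%N by lia.
rewrite (@crush_facet t); last first.
  move=> i /=; rewrite lasso_row_mid // => /seg_neq0.
  by rewrite !inE => ->; rewrite orbT.
rewrite /height /= lasso_row_mid // !entry_seg //; congr petal.
have -> : (t.+1 == t + k.+2)%N = false by lia.
have -> : (t.+1 == t) = false by lia.
have -> : (t + k.+2 == t)%N = false by lia.
by rewrite eqxx !mulr0 mulr1 add0r addr0 subr0 addrAC subrr add0r.
Qed.

Lemma lasso_len (t : 'I_m) : lasso t (len t) = spine 0.
Proof. by rewrite lasso_hi ?subrr // lenE lerDl. Qed.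

(** The homotopy from the collapse of all triangles, at time 0, to [crush] followed
    by the lassos, at time 1.  Both ends are points of the lasso, so the parameters
    are interpolated; on the spine this contracts to the vertex 0. *)
Definition tighten : X * R -> X :=
  glue fst
    (fun t z => lasso t ((1 - clamp01 z.2) * (t.+1%:R + height t z.1)
                         + clamp01 z.2 * (len t * clamp01 (height t z.1))))
    (fun z => spine ((1 - clamp01 z.2) * position z.1)).

(** On {t, t+1} the lasso is still going up the spine, at the position of the
    point; at the apex it is coming back, and L minus the interpolated parameter
    is the contracted position of the apex. *)
Lemma tighten_compat (t : 'I_m) (z : X * R) :
  in_facet k (\val z.1) t -> ~~ active k (\val z.1) t ->
  lasso t ((1 - clamp01 z.2) * (t.+1%:R + height t z.1)
           + clamp01 z.2 * (len t * clamp01 (height t z.1))) =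
  spine ((1 - clamp01 z.2) * position z.1).
Proof.
have /andP[s0 s1] := clamp01_itv z.2; set s := clamp01 z.2 in s0 s1 *.
move=> zt /(height_inactive zt)[[h0 ->]|[h1 ->]].
  rewrite clamp01_le0 // !mulr0 addr0 lasso_lo //.
  have : (0 : R) <= t.+1%:R by [].
  by nra.
rewrite h1 clamp01_ge1 // mulr1 lasso_hi lenE.
  by congr spine; ring.
have : (0 : R) <= (t + k.+2)%:R by [].
by nra.
Qed.

Lemma tighten_facet (t : 'I_m) z : in_facet k (\val z.1) t ->
  tighten z = lasso t ((1 - clamp01 z.2) * (t.+1%:R + height t z.1)
                       + clamp01 z.2 * (len t * clamp01 (height t z.1))).
Proof. by apply: glue_facet; exact: tighten_compat. Qed.

Lemma tighten_edge t z : in_edge (\val z.1) t ->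
  tighten z = spine ((1 - clamp01 z.2) * position z.1).
Proof. exact: glue_edge. Qed.

Lemma tighten_continuous : continuous tighten.
Proof.
have cc (a : R) : continuous (fun _ : X * R => a) by exact: cst_continuous.
have c1 : continuous (fst : X * R -> X) by move=> z; exact: cvg_fst.
have cs : continuous (fun z : X * R => clamp01 z.2).
  by apply: continuous_clamp01 => z; exact: cvg_snd.
have ch t : continuous (fun z : X * R => height t z.1).
  by move=> z; apply: (@continuous_comp _ _ _ fst (height t));
    [exact: c1|exact: height_continuous].
have cp : continuous (fun z : X * R => position z.1).
  by move=> z; apply: (@continuous_comp _ _ _ fst position);
    [exact: c1|exact: position_continuous].
apply: glue_continuous => // [t z|z|]; last exact: tighten_compat.
- apply: (@continuous_comp _ _ _ (fun z : X * R =>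
    (1 - clamp01 z.2) * (t.+1%:R + height t z.1)
    + clamp01 z.2 * (len t * clamp01 (height t z.1))) (lasso t));
    last exact: lasso_continuous.
  apply: continuous_addr; apply: continuous_mulr => //.
  + exact: continuous_subr.
  + exact: continuous_addr.
  + by apply: continuous_mulr => //; exact: continuous_clamp01.
- apply: (@continuous_comp _ _ _ (fun z : X * R =>
    (1 - clamp01 z.2) * position z.1) spine); last exact: spine_continuous.
  by apply: continuous_mulr => //; exact: continuous_subr.
Qed.

Lemma point_cases (x : X) :
  (exists t : 'I_m, in_facet k (\val x) t) \/
  (exists t : 'I_n, in_edge (\val x) t).
Proof.
have [t xt] := point_in_facet x; have [tm|tm] := ltnP t m.
  by left; exists (Ordinal tm).
by right; exists t; apply: in_facet_edge xt; lia.
Qed.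

Lemma position_edge (x : X) t : in_edge (\val x) t ->
  0 <= entry (\val x) t.+1 <= 1 /\ position x = t%:R + entry (\val x) t.+1.
Proof.
move=> xe; have xt := in_edge_facet k xe; have s1 := entry_sum xt.
have := sum_facet (fun i => i%:R) xt; rewrite -/(position x) => ->.
have c0 : entry (\val x) (t + k.+2) = 0.
  apply/eqP; apply: contraT => /entry_neq0[i it] /xe.
  by rewrite it !inE; lia.
have a0 := entry_ge0 x t; have b0 := entry_ge0 x t.+1.
move: s1; rewrite c0 mulr0 !addr0 => s1; split; first by apply/andP; split; lra.
by rewrite (_ : entry _ t = 1 - entry (\val x) t.+1); [rewrite -natr1; ring|lra].
Qed.

Lemma tighten0_edge (x : X) (t : 'I_n) : in_edge (\val x) t ->
  in_edge (\val (tighten (x, 0))) t.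
Proof.
move=> xt; have [b01 xp] := position_edge xt.
rewrite (@tighten_edge t (x, 0) xt) /= clamp01_le0 // subr0 mul1r xp => i /=.
have [tn|tn] := ltnP t.+1 n; first by rewrite spine_seg // => /seg_neq0.
rewrite (_ : entry _ t.+1 = 0); last first.
  apply/eqP; apply: contraT => /entry_neq0[j jt _].
  by have := ltn_ord j; rewrite jt ltnNge tn.
by rewrite addr0 spine_nat // -(seg0 _ _ _ t.+1) => /seg_neq0.
Qed.

Lemma tighten0_facet (x : X) (t : 'I_m) : in_facet k (\val x) t ->
  in_facet k (\val (tighten (x, 0))) t.
Proof.
move=> xt; have tn := apex_lt t.
rewrite (@tighten_facet t (x, 0) xt) /= clamp01_le0 // subr0 mul1r mul0r addr0 => i.
have s1 := entry_sum xt; have a0 := entry_ge0 x t; have b0 := entry_ge0 x t.+1.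
have c0 := entry_ge0 x (t + k.+2)%N.
have [h0|h0] := leP 0 (height t x).
  rewrite lasso_row_mid; last by rewrite h0 /height; lra.
  by move=> /seg_neq0; rewrite !inE => ->; rewrite orbT.
rewrite lasso_row_lo; last by rewrite gerDl ltW.
rewrite -natr1 -addrA spine_seg; last 2 first.
- by lia.
- by move: h0; rewrite /height => h0; apply/andP; split; lra.
by move=> /seg_neq0; rewrite !inE orbA => ->.
Qed.

(** At time 0 a point and its image lie in the same facet. *)
Lemma tighten0_homotopic : homotopic R (fun x => tighten (x, 0)) idfun.
Proof.
apply: homotopic_straight_line => [x|x|x].
- apply: (@continuous_comp _ _ _ (fun x : X => (x, 0 : R)) tighten);
    last exact: tighten_continuous.
  by apply: pair_continuous => y; [exact: cvg_id|exact: cst_continuous].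
- exact: cvg_id.
suff [t [tn rt xt]] : exists t, [/\ (t < n)%N,
    in_facet k (\val (tighten (x, 0))) t & in_facet k (\val x) t].
  exists [set i : 'I_n | (nat_of_ord i \in [:: t; t.+1; t + k.+2])%N]%SET.
    exact: faces_facet.
  by move=> i; rewrite inE => /orP[/rt|/xt].
have [[t xt]|[t xt]] := point_cases x; exists t; split=> //.
- by have := apex_lt t; lia.
- exact: tighten0_facet.
- by apply: in_edge_facet; exact: tighten0_edge.
- exact: in_edge_facet.
Qed.

(** The map from the wedge: all lassos start and end at the vertex 0, so they
    descend to the circles. *)
Lemma lassos_descend : exists g : W -> X, continuous g /\
  forall (t : 'I_m) c, 0 <= c <= 1 -> g (petal t c) = lasso t (len t * c).
Proof.
have [t|t t' s s01|t s s01|phi [cphi phiE]] :=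
    @wedge_homotopy R m X (fun t z => lasso t (len t * z.1)).
- move=> z; apply: (@continuous_comp _ _ _
    (fun z : R * R => len t * z.1) (lasso t)); last exact: lasso_continuous.
  by apply: continuous_mulr => [|?]; [exact: cst_continuous|exact: cvg_fst].
- by rewrite !mulr0 !lasso_lo.
- by rewrite /= mulr1 mulr0 lasso_len lasso_lo.
exists (fun w => phi (w, 0)); split; last first.
  by move=> t c c01; rewrite phiE // lexx ler01.
apply: (within_comp_continuous cphi) => [|w]; last first.
  by split=> //=; rewrite in_itv /= lexx ler01.
by apply: pair_continuous => y; [exact: cvg_id|exact: cst_continuous].
Qed.

Lemma realization_wedge : homotopy_equivalent R X W.
Proof.
have [g [cg gE]] := lassos_descend.
exists crush, g; split=> //; first exact: crush_continuous.
  apply: homotopic_trans tighten0_homotopic; apply: homotopic_sym.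
  apply/homotopicP; exists tighten; split=> // [|x]; first exact: tighten_continuous.
  have [[t xt]|[t xt]] := point_cases x.
    rewrite (@tighten_facet t (x, 1) xt) /= clamp01_ge1 // subrr mul0r add0r mul1r.
    rewrite (crush_facet xt) -gE ?clamp01_itv //; congr g.
    by rewrite /petal loop_clamp.
  rewrite (@tighten_edge t (x, 1) xt) /= clamp01_ge1 // subrr mul0r.
  by rewrite (crush_edge xt) /base gE ?lexx ?ler01 // mulr0 lasso_lo.
(* Going around the t-th lasso at speed L, [crush] only sees the parameter
   L c - (t + 1); it is moved linearly to c, staying at most 0 at c = 0 and at
   least 1 at c = 1. *)
have [t|t t' s s01|t s s01|phi [cphi phiE]] := @wedge_homotopy R m W
    (fun t z => petal t ((1 - z.2) * (len t * z.1 - t.+1%:R) + z.2 * z.1)).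
- have c1 : continuous (fst : R * R -> R) by move=> z; exact: cvg_fst.
  have c2 : continuous (snd : R * R -> R) by move=> z; exact: cvg_snd.
  have cc (a : R) : continuous (fun _ : R * R => a) by exact: cst_continuous.
  move=> z; apply: (@continuous_comp _ _ _ (fun z : R * R =>
    (1 - z.2) * (len t * z.1 - t.+1%:R) + z.2 * z.1) (petal t));
    last exact: petal_continuous.
  apply: continuous_addr; apply: continuous_mulr => //; apply: continuous_subr => //.
  exact: continuous_mulr.
- have /andP[s0 s1] := s01.
  have neg (u : 'I_m) : (1 - s) * (len u * 0 - u.+1%:R) + s * 0 <= 0.
    have : (0 : R) <= u.+1%:R by [].
    by nra.
  by rewrite !petal_le0 //= neg.
- have /andP[s0 s1] := s01.
  rewrite petal_ge1 ?petal_le0 //= lenE.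
    have : (0 : R) <= t.+1%:R by [].
    by nra.
  have : (0 : R) <= (t + k.+2)%:R by [].
  by nra.
exists phi; split=> // w; have [t [c c01 <-]] := petal_surj w.
  by rewrite phiE ?lexx ?ler01 //= gE // crush_lasso subr0 mul1r mul0r addr0.
by rewrite phiE ?lexx ?ler01 //= subrr mul0r add0r mul1r.
Qed.

End Avalanche.

Theorem proposition3p9 (R : realType) (k n : nat)
  (hk : (1 <= k)%N) (hn : (k + 3 <= n)%N) :
  homotopy_equivalent R
    (realization R (avalanche_complex (initial_config n k)))
    (wedge_spheres R (n - k - 2)%N 1).
Proof. exact: realization_wedge. Qed.
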